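(* Let $G$ be a probability distribution function on $[0,\infty)$ with finite mean equal to $1$ and a density $g$, whose hazard rate $h(x)=g(x)/(1-G(x))$ satisfies $\sup_{x\in[0,\infty)} h(x)\le H$ for some constant $H<\infty$, and write $\overline G=1-G$. Let $\lambda$ be a non-negative locally integrable function on $[0,\infty)$ (i.e. $\int_0^T\lambda(t)\,dt<\infty$ for every $T<\infty$), and let $Z^0_\ell\in\mathbb{C}^1_{\le 1}[0,\infty)$ for every $\ell\ge1$. Then the hydrodynamic PDE associated to $(\lambda, Z^0_\ell;\ell\ge1)$ has at most one solution $(Z_\ell;\ell\ge1)$ with $Z_\ell\in\mathbb{X}$ for all $\ell\ge1$.
   Context: $\mathbb{C}^1_{\le 1}[0,\infty)$ denotes the space of continuously differentiable functions $f$ on $[0,\infty)$ with bounded derivative and $|f|\le 1$. $\mathbb{X}$ denotes the set of functions $\varphi$ on $[0,\infty)\times[0,\infty)$ such that for every $t\ge0$, $\varphi(t,\cdot)\in\mathbb{C}^1_{\le1}[0,\infty)$, and for every $r\ge0$ the map $t\mapsto\varphi(t,r)$ is measurable; $\partial_r\varphi$ denotes the derivative in the second variable. A family $(Z_\ell;\ell\ge1)$ with $Z_\ell\in\mathbb{X}$ solves the hydrodynamic PDE associated to $(\lambda,Z^0_\ell;\ell\ge1)$ if for all $t,r\ge0$: $Z_1(t,r)=Z_1^0(t+r)-\int_0^t\overline G(t+r-u)\partial_rZ_2(u,0)\,du+\int_0^t\lambda(u)\overline G(t+r-u)(1-Z_1(u,0)^2)\,du$, $Z_1(t,0)=Z_1^0(0)+\int_0^t(\partial_rZ_1(u,0)-\partial_rZ_2(u,0))\,du+\int_0^t\lambda(u)(1-Z_1(u,0)^2)\,du$,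 and for every $\ell\ge2$: $Z_\ell(t,r)=Z_\ell^0(t+r)-\int_0^t\overline G(t+r-u)\partial_rZ_{\ell+1}(u,0)\,du+\int_0^t\lambda(u)(Z_{\ell-1}(u,0)+Z_\ell(u,0))(Z_{\ell-1}(u,t+r-u)-Z_\ell(u,t+r-u))\,du$, $Z_\ell(t,0)=Z_\ell^0(0)+\int_0^t(\partial_rZ_\ell(u,0)-\partial_rZ_{\ell+1}(u,0))\,du+\int_0^t\lambda(u)(Z_{\ell-1}(u,0)^2-Z_\ell(u,0)^2)\,du$. *)

(* Defs.v *)
From HB Require Import structures.
From mathcomp Require Import all_boot all_order all_algebra.
From mathcomp Require Import all_classical all_reals all_analysis.
Set Implicit Arguments. Unset Strict Implicit. Unset Printing Implicit Defensive.
Import Order.TTheory GRing.Theory Num.Theory.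
Import numFieldNormedType.Exports.
Local Open Scope classical_set_scope.
Local Open Scope ring_scope.

Section Defs.
Variable R : realType.
Local Notation mu := (@lebesgue_measure R).

Definition has_deriv_on_halfline (f : R -> R) (x d : R) : Prop :=
  (fun h : R => h^-1 * (f (x + h) - f x))
    @ (within [set h : R | 0 <= x + h] (0 : R)^') --> d.

(* C^1_{<=1}[0,oo): continuously differentiable on [0,oo), bounded derivative,
   |f| <= 1 on [0,oo).  Values at negative arguments are irrelevant. *)
Definition C1le1 (f : R -> R) : Prop :=
  (forall x, 0 <= x -> `|f x| <= 1) /\
  exists f' : R -> R,
    (forall x, 0 <= x -> has_deriv_on_halfline f x (f' x)) /\
    {within [set x : R | 0 <= x], continuous f'} /\
    (exists M : R, forall x, 0 <= x -> `|f' x| <= M).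

Definition inX (phi : R -> R -> R) : Prop :=
  (forall t, 0 <= t -> C1le1 (phi t)) /\
  (forall r, 0 <= r -> measurable_fun [set t : R | 0 <= t] (fun t => phi t r)).

Definition dr0 (f : R -> R) : R :=
  lim ((fun h : R => h^-1 * (f h - f 0)) @ (0 : R)^'+).

Definition intg (t : R) (F : R -> R) : Prop :=
  mu.-integrable `[0, t] (fun u => (F u)%:E).
Definition integ (t : R) (F : R -> R) : R := Rintegral mu `[0, t] F.

Definition solves_hydro (Gbar lam : R -> R) (Z0 : nat -> R -> R)
    (Z : nat -> R -> R -> R) : Prop :=
  (forall t r, 0 <= t -> 0 <= r ->
     intg t (fun u => Gbar (t + r - u) * dr0 (Z 2%N u)) /\
     intg t (fun u => lam u * Gbar (t + r - u) * (1 - Z 1%N u 0 ^+ 2)) /\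
     Z 1%N t r = Z0 1%N (t + r)
                 - integ t (fun u => Gbar (t + r - u) * dr0 (Z 2%N u))
                 + integ t (fun u => lam u * Gbar (t + r - u) * (1 - Z 1%N u 0 ^+ 2))) /\
  (forall t, 0 <= t ->
     intg t (fun u => dr0 (Z 1%N u) - dr0 (Z 2%N u)) /\
     intg t (fun u => lam u * (1 - Z 1%N u 0 ^+ 2)) /\
     Z 1%N t 0 = Z0 1%N 0
                 + integ t (fun u => dr0 (Z 1%N u) - dr0 (Z 2%N u))
                 + integ t (fun u => lam u * (1 - Z 1%N u 0 ^+ 2))) /\
  (forall (l : nat) t r, (2 <= l)%N -> 0 <= t -> 0 <= r ->
     intg t (fun u => Gbar (t + r - u) * dr0 (Z l.+1 u)) /\
     intg t (fun u => lam u * (Z l.-1 u 0 + Z l u 0)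
                      * (Z l.-1 u (t + r - u) - Z l u (t + r - u))) /\
     Z l t r = Z0 l (t + r)
               - integ t (fun u => Gbar (t + r - u) * dr0 (Z l.+1 u))
               + integ t (fun u => lam u * (Z l.-1 u 0 + Z l u 0)
                                   * (Z l.-1 u (t + r - u) - Z l u (t + r - u)))) /\
  (forall (l : nat) t, (2 <= l)%N -> 0 <= t ->
     intg t (fun u => dr0 (Z l u) - dr0 (Z l.+1 u)) /\
     intg t (fun u => lam u * (Z l.-1 u 0 ^+ 2 - Z l u 0 ^+ 2)) /\
     Z l t 0 = Z0 l 0
               + integ t (fun u => dr0 (Z l u) - dr0 (Z l.+1 u))
               + integ t (fun u => lam u * (Z l.-1 u 0 ^+ 2 - Z l u 0 ^+ 2))).

Definition good_G (G g : R -> R) (H : R) : Prop :=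
  measurable_fun setT g /\
  (forall x, 0 <= g x) /\
  (forall x, x < 0 -> G x = 0) /\
  (forall x, 0 <= x -> (\int[mu]_(y in `[0%R, x]%classic) (g y)%:E)%E = (G x)%:E) /\
  (\int[mu]_(y in `[0%R, +oo[%classic) (g y)%:E)%E = 1%:E /\
  (\int[mu]_(y in `[0%R, +oo[%classic) (y * g y)%:E)%E = 1%:E /\
  (forall x, 0 <= x -> g x / (1 - G x) <= H).

Definition good_lambda (lam : R -> R) : Prop :=
  (forall t, 0 <= t -> 0 <= lam t) /\
  (forall T, 0 <= T -> mu.-integrable `[0, T] (fun u => (lam u)%:E)).
End Defs.

(* Main.v *)
Require Import Defs.
From HB Require Import structures.
From mathcomp Require Import all_boot all_order all_algebra.
From mathcomp Require Import all_classical all_reals all_analysis.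
From mathcomp Require Import measurable_realfun ring lra.
Import Order.TTheory GRing.Theory Num.Theory.
Import numFieldNormedType.Exports.
Local Open Scope classical_set_scope.
Local Open Scope ring_scope.
Set Implicit Arguments.
Unset Strict Implicit.

(** Let [W_l] be the difference of two solutions, [w_l] its [r]-derivative at
    [0] and [A_l(t) = int_0^t w_l].  The two equations for [Z_l], taken at
    [r = 0], combine to [A_l = g * A_(l+1) + int lam (...)], the parenthesis
    being linear in [W_(l-1), W_l]; and [W_l(t, r)] is bounded by
    [|A_(l+1)(t)|] plus terms of the same kind.  So [A_l] gains a factor of the
    order of the length of the time interval at the price of raising the index.
    Since [|W_l| <= 2] and [A_(l+1) = A_l - W_l(., 0) + int lam (...)], both
    families are a priori [O(2^l)].  If they vanish before a time [s], then on a
    short interval after [s] a bound [b 2^l] improves to [(b/2) 2^l], hence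
    they vanish there as well. *)

(** * Integrals over [[0, t]], real induction, and a substitute for integration by parts *)

Section Integrals.
Context {R : realType}.
Local Notation mu := (@lebesgue_measure R).
Implicit Types (f k w : R -> R) (s t a b : R).

(** If [P t] failed, [t] would bound the set [S] of those [x] below which [P] holds. The step taken
    at [sup S] then puts a strictly larger point into [S]. At [t = 0] the premise of the step is
    vacuous, so it also starts the induction. *)
Lemma real_induction (P : R -> Prop) :
  (forall t, 0 <= t -> (forall s, 0 <= s -> s < t -> P s) ->
     exists2 t1, t < t1 & forall s, t <= s -> s <= t1 -> P s) ->
  forall t, 0 <= t -> P t.
Proof.
move=> step t t0; apply: contrapT => nPt.
pose S := [set x : R | 0 <= x /\ forall s, 0 <= s -> s < x -> P s].
have S0 : S 0 by split => // s s0; rewrite ltNge s0.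
have ubS : ubound S t.
  by move=> x [x0 xP]; rewrite leNgt; apply/negP => tx; apply/nPt/xP.
have hS : has_sup S by split; [exists 0 | exists t].
have sS0 : 0 <= sup S by apply: ub_le_sup => //; exists t.
have Pb s : 0 <= s -> s < sup S -> P s.
  move=> s0 ssup; have [e [_ eP] se] := @sup_gt _ S s (ex_intro _ 0 S0) ssup.
  exact: eP.
have [t1 lt1 Pt1] := step _ sS0 Pb.
suff : S t1 by move=> St1; move: lt1; rewrite ltNge => /negP; apply;
  apply: ub_le_sup => //; exists t.
split; first exact: le_trans (ltW lt1).
move=> s s0 st1; have [?|?] := ltP s (sup S); first exact: Pb.
exact/Pt1/ltW.
Qed.

Lemma intgS s t f : s <= t -> intg t f -> intg s f.
Proof.
move=> st; apply: integrableS => //; apply: subset_itvl.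
by rewrite bnd_simp.
Qed.

Lemma intgD t f k : intg t f -> intg t k -> intg t (fun u => f u + k u).
Proof. by move=> itf itk; exact: (integrableD _ itf itk). Qed.

Lemma intgB t f k : intg t f -> intg t k -> intg t (fun u => f u - k u).
Proof. by move=> itf itk; exact: (integrableB _ itf itk). Qed.

Lemma intgZ t c f : intg t f -> intg t (fun u => c * f u).
Proof. by move=> itf; exact: (integrableZl _ c itf). Qed.

Lemma intg_norm t f : intg t f -> intg t (fun u => `|f u|).
Proof. by move=> ?; apply: integrable_norm. Qed.

Lemma intg_cst t (c : R) : intg t (fun=> c).
Proof.
apply/integrableP; split; first exact/measurable_EFinP.
under eq_integral do rewrite /=.
rewrite integral_cst//= lebesgue_measure_itv/=.
by case: ifPn => _; rewrite ?mule0 // -EFinD -EFinM ltry.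
Qed.

Lemma integB t f k : intg t f -> intg t k ->
  integ t (fun u => f u - k u) = integ t f - integ t k.
Proof. by move=> ? ?; apply: RintegralB. Qed.

Lemma integZ t c f : intg t f -> integ t (fun u => c * f u) = c * integ t f.
Proof. by move=> ?; apply: RintegralZl. Qed.

Lemma integ_cst t c : 0 <= t -> integ t (fun=> c) = c * t.
Proof.
move=> t0; rewrite /integ Rintegral_cst//= lebesgue_measure_itv/= lte_fin.
by case: ltP => //= [_|t0']; rewrite ?subr0//; have -> : t = 0 by lra.
Qed.

Lemma integ0 f : integ 0 f = 0.
Proof. by rewrite /integ set_itv1 Rintegral_set1. Qed.

Lemma integ_diff s t f : 0 <= s -> s <= t -> intg t f ->
  integ t f - integ s f = Rintegral mu `]s, t[ f.
Proof.
move=> s0 st itf; rewrite /integ Rintegral_itvB//= ?bnd_simp//.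
rewrite -Rintegral_itv_bndo_bndc//; apply: integrableS itf => //.
by apply: subset_itv; rewrite bnd_simp.
Qed.

(** Endpoints are null sets, so the pointwise bound is asked on the open interval only. This fits
    real induction, where information is available strictly before [t]. *)
Lemma norm_integ_diff_le s t f k : 0 <= s -> s <= t ->
  intg t f -> intg t k -> (forall u, s < u -> u < t -> `|f u| <= k u) ->
  `|integ t f - integ s f| <= integ t k - integ s k.
Proof.
move=> s0 st itf itk fk; rewrite !integ_diff//.
have sub : `]s, t[ `<=` `[0, t] by apply: subset_itv; rewrite bnd_simp.
have iS h : intg t h -> mu.-integrable `]s, t[ (EFin \o h).
  by move=> ith; apply: integrableS ith.
apply: le_trans (le_normr_Rintegral _ (iS _ itf)) _ => //.
apply: le_Rintegral => //; [exact: (iS _ (@intg_norm _ _ itf))|exact: iS|].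
by move=> u /=; rewrite in_itv/= => /andP[]; exact: fk.
Qed.

Lemma norm_integ_le t f k : 0 <= t -> intg t f -> intg t k ->
  (forall u, 0 < u -> u < t -> `|f u| <= k u) -> `|integ t f| <= integ t k.
Proof.
move=> t0 itf itk fk.
by have := @norm_integ_diff_le 0 t f k (lexx _) t0 itf itk fk; rewrite !integ0 !subr0.
Qed.

Lemma ge0_integ_mono s t f : 0 <= s -> s <= t -> intg t f ->
  (forall u, 0 <= u -> u <= t -> 0 <= f u) -> integ s f <= integ t f.
Proof.
move=> s0 st itf f0; rewrite -subr_ge0 integ_diff//.
apply: Rintegral_ge0 => u /=; rewrite in_itv/= => /andP[su ut].
by apply: f0; lra.
Qed.

(** Right continuity of the indefinite integral: it provides the room to the right of [t] in each
    use of [real_induction]. *)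
Lemma integ_right_small t f (e : R) : 0 <= t -> 0 < e ->
  (forall T, 0 <= T -> intg T f) ->
  exists2 t1, t < t1 & `|integ t1 f - integ t f| < e.
Proof.
move=> t0 e0 itf.
have tt : t < t + 1 by lra.
have it1 : mu.-integrable `[t, t + 1] (EFin \o f).
  have : intg (t + 1) f by apply: itf; lra.
  by apply: integrableS => //; apply: subset_itv; rewrite bnd_simp.
have := @parameterized_integral_near_left R t (t + 1) e f tt e0 it1.
move=> /nbhs_ballP[d /= d0 dP].
pose t1 := t + Num.min (d / 2) 1.
have m0 : 0 < Num.min (d / 2) 1 by rewrite lt_min; apply/andP; split; lra.
have m1 : Num.min (d / 2) 1 <= d / 2 by rewrite ge_min lexx.
have m2 : Num.min (d / 2) 1 <= 1 by rewrite ge_min lexx orbT.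
have lt1 : t < t1 by rewrite /t1; lra.
exists t1 => //.
have := dP t1; rewrite /ball/= => /(_ _ (ltW lt1)).
have -> : `|t - t1| < d by rewrite ltr0_norm /t1; lra.
move=> /(_ isT); rewrite /parameterized_integral /integ Rintegral_itvB//= ?bnd_simp//; last 2 first.
- by apply: itf; lra.
- exact: ltW.
rewrite Rintegral_itv_obnd_cbnd//.
by apply: integrableS it1 => //; apply: subset_itv; rewrite bnd_simp ?lexx// /t1; lra.
Qed.

(* Over the partition of [a, b] into n equal pieces the errors telescope to
   H * ((b - a) / n) * (N b - N a). *)
Lemma lipschitz_up_to_variation (E N : R -> R) (H bt a b : R) : 0 <= H -> a <= b ->
  (forall s t, a <= s -> s < t -> t <= b ->
    `|E t - E s| <= H * (t - s) * (bt + (N t - N s))) ->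
  `|E b - E a| <= H * bt * (b - a).
Proof.
move=> H0; rewrite le_eqVlt => /predU1P[<- _|ab inc].
  by rewrite !subrr normr0 mulr0.
have part n : (0 < n)%N ->
    `|E b - E a| <= H * bt * (b - a) + H * (b - a) * (N b - N a) / n%:R.
  move=> n0; have nR : (0 : R) < n%:R by rewrite ltr0n.
  pose d := (b - a) / n%:R; have d0 : 0 < d by rewrite divr_gt0// subr_gt0.
  have dn : d * n%:R = b - a by rewrite /d divfK// lt0r_neq0.
  have key (k : nat) : (k <= n)%N -> `|E (a + d * k%:R) - E a| <=
      H * bt * (d * k%:R) + H * d * (N (a + d * k%:R) - N a).
    elim: k => [_|k ih kn]; first by rewrite mulr0 addr0 !subrr normr0; lra.
    have kn' : d * k.+1%:R <= b - a by rewrite -dn ler_pM2l// ler_nat.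
    have dk0 : 0 <= d * k%:R by rewrite mulr_ge0// ltW.
    have dk : d * k.+1%:R = d * k%:R + d by rewrite -natr1 mulrDr mulr1.
    have := ih (ltnW kn); have := inc (a + d * k%:R) (a + d * k.+1%:R).
    move=> /(_ ltac:(lra) ltac:(lra) ltac:(lra)).
    have -> : a + d * k.+1%:R - (a + d * k%:R) = d by lra.
    set x := E _; set y := E _; set z := E _; move: (N _) (N _) (N _) => n1 n2 n3.
    move=> A B; apply: le_trans (ler_distD y _ _) _.
    apply: le_trans (lerD A B) _; rewrite dk; lra.
  have := key n (leqnn n); rewrite dn; have -> : a + (b - a) = b by lra.
  move=> /le_trans; apply; rewrite lerD2l /d le_eqVlt; apply/orP; left.
  by apply/eqP; ring.
(* A nonpositive error term is dropped with [n = 1]; a positive one is brought below any [e] by a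
   large [n]. *)
have [NN|NN] := leP (H * (b - a) * (N b - N a)) 0.
  apply: le_trans (part 1%N isT) _; rewrite divr1; lra.
apply/ler_addgt0Pr => e e0.
have [n nP] : exists n : nat, (H * (b - a) * (N b - N a)) / e < n%:R.
  exists (Num.Def.truncn ((H * (b - a) * (N b - N a)) / e)).+1.
  exact: truncnS_gt.
have nR : (0 : R) < n%:R by apply: le_lt_trans nP; rewrite divr_ge0 // ltW.
apply: le_trans (part n _) _; first by rewrite -(ltr0n R).
by rewrite lerD2l ler_pdivrMr// [e * _]mulrC -ler_pdivrMr// ltW.
Qed.

(* A substitute for integration by parts, with E s = int_0^s phi w - phi(s) A(s). *)
Lemma norm_integM_sub_le (phi w : R -> R) (H bt s0 t : R) :
  0 <= H -> 0 <= s0 -> s0 <= t ->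
  (forall x y, 0 <= x -> x <= y -> y <= t -> `|phi x - phi y| <= H * (y - x)) ->
  intg t w -> intg t (fun u => phi u * w u) ->
  (forall s, 0 <= s -> s < s0 -> integ s w = 0) ->
  (forall s, s0 <= s -> s <= t -> `|integ s w| <= bt) ->
  `|integ t (fun u => phi u * w u) - phi t * integ t w| <= H * bt * (t - s0).
Proof.
move=> H0 s00 s0t lip iw ipw A0 Ab.
pose E s := integ s (fun u => phi u * w u) - phi s * integ s w.
pose N s := integ s (fun u => `|w u|).
have inc x y : 0 <= x -> x < y -> y <= t ->
    `|E y - E x| <= H * (y - x) * (`|integ x w| + (N y - N x)).
  move=> x0 /ltW xy yt.
  have iwy : intg y w by exact: intgS iw.
  have ipwy : intg y (fun u => phi u * w u) by exact: intgS ipw.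
  have iwx : intg x w by exact: intgS iwy.
  have ipwx : intg x (fun u => phi u * w u) by exact: intgS ipwy.
  pose f u := phi u * w u - phi y * w u.
  have fI z : intg z w -> intg z (fun u => phi u * w u) ->
      integ z f = integ z (fun u => phi u * w u) - phi y * integ z w.
    by move=> iz1 iz2; rewrite /f integB ?integZ//; exact: intgZ.
  (* Freezing [phi] at [y] leaves the integral of [(phi u - phi y) * w u] over [[x, y]] and a
     multiple of [integ x w]; the Lipschitz bound controls both. *)
  have -> : E y - E x = (integ y f - integ x f) + (phi x - phi y) * integ x w.
    by rewrite !fI// /E; ring.
  apply: le_trans (ler_normD _ _) _; rewrite mulrDr addrC; apply: lerD.
    rewrite normrM ler_wpM2r//.
    exact: lip.
  have := @norm_integ_diff_le x y f (fun u => (H * (y - x)) * `|w u|).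
  rewrite !integZ; last 2 first.
  - exact: intg_norm.
  - exact: intg_norm.
  rewrite -mulrBr; apply => //.
  - by apply: intgB => //; exact: intgZ.
  - exact/intgZ/intg_norm.
  move=> u xu uy; rewrite /f -mulrBl normrM ler_wpM2r//.
  apply: le_trans (lip u y _ _ _) _; rewrite ?ler_wpM2l//; lra.
have e0 : E 0 = 0 by rewrite /E !integ0 mulr0 subr0.
(* The increments involve [integ x w] at left endpoints [x < s0] only, where it vanishes, so
   [bt = 0] is allowed on [[0, s0]]. *)
have es0 : E s0 = 0.
  have : `|E s0 - E 0| <= H * 0 * (s0 - 0).
    apply: (@lipschitz_up_to_variation E N) => //.
    move=> x y x0 xy ys0.
    by have := inc x y x0 xy (le_trans ys0 s0t); rewrite (A0 x)// ?normr0//; lra.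
  by rewrite mulr0 mul0r e0 subr0 normr_le0 => /eqP.
have := @lipschitz_up_to_variation E N H bt s0 t H0 s0t.
rewrite es0 subr0; apply => x y s0x xy yt.
apply: le_trans (inc x y _ xy yt) _; first by lra.
have Hxy : 0 <= H * (y - x) by rewrite mulr_ge0//; lra.
by apply: ler_wpM2l => //; rewrite lerD2r; apply: Ab; lra.
Qed.

End Integrals.

(** * Positivity and Lipschitz continuity of the tail [1 - G] *)

Section Distribution.
Context {R : realType}.
Local Notation mu := (@lebesgue_measure R).
Variables (G g : R -> R) (H : R).
Hypothesis hG : good_G G g H.

Let g_ge0 x : 0 <= g x.
Proof. by have [_ []] := hG. Qed.

Lemma intg_density t : intg t g.
Proof.
have [mg [_ [_ [_ [I1 _]]]]] := hG.
have igy : mu.-integrable `[0, +oo[ (EFin \o g).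
  apply/integrableP; split.
    by apply/measurable_EFinP; apply: measurable_funS mg.
  under eq_integral do rewrite /= ger0_norm//.
  by rewrite I1 ltry.
by apply: integrableS igy => //; apply: subset_itvl.
Qed.

Lemma distr_integ x : 0 <= x -> G x = integ x g.
Proof.
by have [_ [_ [_ [I0 _]]]] := hG; move=> x0; rewrite /integ /Rintegral I0.
Qed.

Lemma distr0 : G 0 = 0.
Proof. by rewrite distr_integ// integ0. Qed.

Lemma distr_mono x y : 0 <= x -> x <= y -> G x <= G y.
Proof.
move=> x0 xy; rewrite !distr_integ ?(le_trans x0)//.
by apply: ge0_integ_mono => //; exact: intg_density.
Qed.

Let density_le x : 0 <= x -> G x < 1 -> g x <= `|H| * (1 - G x).
Proof.
have [_ [_ [_ [_ [_ [_ hz]]]]]] := hG => x0 Gx.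
rewrite -ler_pdivrMr ?subr_gt0//.
by apply: le_trans (hz _ x0) _; exact: ler_norm.
Qed.

(** Where [G x = 1] the hazard quotient is [0] by convention and says nothing about [g x], so
    positivity of the tail must be proved. While [G < 1] on [[y, t)], the density there is at most
    [|H| * (1 - G y)]; over a length [d] with [|H| * d <= 1/2] the tail loses at most half of its
    value and cannot reach [0]. *)
Lemma distr_lt1 x : 0 <= x -> G x < 1.
Proof.
move: x; apply: real_induction => t t0 ih.
have Gt : G t < 1.
  have := t0; rewrite le_eqVlt => /predU1P[<-|tp]; first by rewrite distr0.
  pose d := (2 * (`|H| + 1))^-1.
  have H0 := normr_ge0 H.
  have d0 : 0 < d by rewrite invr_gt0; lra.
  have dH : `|H| * d <= 2^-1.
    rewrite /d invfM mulrCA ler_piMr ?invr_ge0// ler_pdivrMr; lra.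
  pose y := Num.max 0 (t - d).
  have y0 : 0 <= y by rewrite le_max lexx.
  have yt : y < t by rewrite gt_max tp; lra.
  have yd : t - y <= d.
    by have : t - d <= y by [rewrite le_max lexx orbT]; lra.
  have Gy := ih _ y0 yt.
  have : `|integ t g - integ y g| <= `|H| * (1 - G y) * (t - y).
    have -> : `|H| * (1 - G y) * (t - y) = integ t (fun=> `|H| * (1 - G y))
        - integ y (fun=> `|H| * (1 - G y)) by rewrite !integ_cst//; ring.
    apply: norm_integ_diff_le => //; [exact: ltW|exact: intg_density| |].
      exact: intg_cst.
    move=> u yu ut; rewrite ger0_norm//.
    have u0 : 0 <= u by lra.
    apply: le_trans (density_le u0 (ih _ u0 ut)) _.
    by rewrite ler_wpM2l// lerD2l lerN2 distr_mono// ltW.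
  rewrite -!distr_integ//.
  have : `|H| * (t - y) <= 2^-1.
    by apply: le_trans dH; rewrite ler_wpM2l.
  move=> le2 /ler_normlP[_] le1.
  have : (1 - G y) * (`|H| * (t - y)) <= (1 - G y) * 2^-1.
    by rewrite ler_wpM2l//; lra.
  lra.
(* The remaining tail [1 - G t] is the tolerance: it gives [G t1 < 1], and monotonicity covers the
   points between. *)
have [t1 tt1] := integ_right_small t0 (ltac:(rewrite subr_gt0; exact: Gt) : 0 < 1 - G t)
  (fun T _ => intg_density T).
rewrite -!distr_integ ?(le_trans t0 (ltW tt1))// => /ltr_normlP[_ ltG].
exists t1 => // s ts st1; have := @distr_mono s t1 (le_trans t0 ts) st1; lra.
Qed.

Lemma distr_neg x : x < 0 -> G x = 0.
Proof. by have [_ [_ [+ _]]] := hG; exact. Qed.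

Lemma tail_bounds x : 0 < 1 - G x <= 1.
Proof.
have [x0|x0] := leP 0 x; last by rewrite distr_neg//; lra.
have := distr_lt1 x0; have := distr_mono (lexx 0) x0; rewrite distr0; lra.
Qed.

(** With a positive tail the hazard bound becomes [g <= |H| * (1 - G) <= |H|]; on the negative axis
    the tail is constant. *)
Lemma tail_lipschitz x y : x <= y -> `|(1 - G x) - (1 - G y)| <= `|H| * (y - x).
Proof.
have pos a b : 0 <= a -> a <= b -> `|G b - G a| <= `|H| * (b - a).
  move=> a0 ab; have b0 := le_trans a0 ab.
  rewrite !distr_integ//.
  have -> : `|H| * (b - a) = integ b (fun=> `|H|) - integ a (fun=> `|H|).
    by rewrite !integ_cst//; ring.
  apply: norm_integ_diff_le => //; [exact: intg_density|exact: intg_cst|].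
  move=> u au ub; have u0 : 0 <= u by lra.
  rewrite ger0_norm//; apply: le_trans (density_le u0 (distr_lt1 u0)) _.
  by rewrite ler_piMr//; have := tail_bounds u; lra.
move=> xy; have -> : (1 - G x) - (1 - G y) = G y - G x by ring.
have [x0|x0] := leP 0 x; first exact: pos.
have [y0|y0] := leP 0 y; last first.
  by rewrite !distr_neg// subrr normr0 mulr_ge0//; lra.
rewrite (distr_neg x0) -distr0; apply: le_trans (pos 0 y (lexx _) y0) _.
by rewrite ler_wpM2l//; lra.
Qed.

Lemma continuous_tail : continuous (fun x => 1 - G x).
Proof.
move=> x; apply/cvgrPdist_lt => e e0; near=> y.
suff : `|(1 - G x) - (1 - G y)| <= `|H| * `|x - y|.
  move/le_lt_trans; apply.
  have H0 := normr_ge0 H.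
  have : `|x - y| < e / (`|H| + 1).
    by near: y; apply: (@cvgr_dist_lt _ _ _ _ _ id) => //; rewrite divr_gt0//; lra.
  by rewrite ltr_pdivlMr ?ltr_wpDl//; have := normr_ge0 (x - y); nra.
have [xy|/ltW yx] := leP x y.
  by rewrite [X in _ * X]distrC (ger0_norm (_ : 0 <= y - x)) ?subr_ge0//; exact: tail_lipschitz.
by rewrite distrC (ger0_norm (_ : 0 <= x - y)) ?subr_ge0//; exact: tail_lipschitz.
Unshelve. all: by end_near. Qed.

(** The interior equations provide integrability of the boundary derivative with the tail as weight.
    On [[0, t]] the inverse weight is continuous and at most [(1 - G t)^-1], so the weight can be
    divided out. *)
Lemma intg_div_tail (t : R) (w : R -> R) : 0 <= t ->
  intg t (fun u => (1 - G (t - u)) * w u) -> intg t w.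
Proof.
move=> t0 itw.
have m0 : 0 < 1 - G t by have /andP[] := tail_bounds t.
pose h u := (1 - G (t - u))^-1.
have mh : measurable_fun `[0, t] h.
  apply: (@measurable_funS _ _ _ _ setT) => //.
  apply: continuous_measurable_fun => x; apply: cvgV.
    by rewrite gt_eqF//; have /andP[] := tail_bounds (t - x).
  apply: (@continuous_comp _ _ _ (fun u => t - u) (fun x => 1 - G x)).
    by apply: cvgB; [exact: cvg_cst|exact: cvg_id].
  exact: continuous_tail.
have bh : [bounded h x | x in `[0, t]].
  exists (1 - G t)^-1; split; first exact: num_real.
  move=> M /ltW M0 u /=; rewrite in_itv/= => /andP[u0 ut].
  have tu : 0 < 1 - G (t - u) by have /andP[] := tail_bounds (t - u).
  apply: le_trans M0; rewrite /h ger0_norm ?invr_ge0 ?(ltW tu)//.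
  rewrite lef_pV2 ?posrE// lerD2l lerN2; apply: distr_mono; lra.
have := @integrableMr _ _ _ mu _ _ h _ mh bh itw; 
move=> /(_ (measurable_itv _)); apply: (@eq_integrable _ _ _ mu) => // u _ /=.
rewrite -EFinM /h mulKf// gt_eqF//.
by have /andP[] := tail_bounds (t - u).
Qed.

End Distribution.

(** * The linear hierarchy satisfied by the difference of two solutions vanishes *)

Section LinearHierarchy.
Context {R : realType}.
Variables (B lam : R -> R) (H : R).
Variables (W : nat -> R -> R -> R) (w : nat -> R -> R).
Variables (F : nat -> R -> R -> R) (f : nat -> R -> R).
Hypothesis H0 : 0 <= H.
Hypothesis B01 : forall x, 0 < B x <= 1.
Hypothesis B0 : B 0 = 1.
Hypothesis Blip : forall x y, x <= y -> `|B x - B y| <= H * (y - x).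
Hypothesis lam0 : forall t, 0 <= t -> 0 <= lam t.
Hypothesis ilam : forall t, 0 <= t -> intg t lam.
Hypothesis iw : forall l t, 0 <= t -> intg t (w l).
Hypothesis iBw : forall l t r, 0 <= t -> 0 <= r ->
  intg t (fun u => B (t + r - u) * w l.+1 u).
Hypothesis iF : forall l t r, 0 <= t -> 0 <= r -> intg t (F l (t + r)).
Hypothesis jf : forall l t, 0 <= t -> intg t (f l).
Hypothesis Wtr : forall l t r, 0 <= t -> 0 <= r ->
  W l t r = - integ t (fun u => B (t + r - u) * w l.+1 u) + integ t (F l (t + r)).
Hypothesis Wt0 : forall l t, 0 <= t ->
  W l t 0 = integ t (w l) - integ t (w l.+1) + integ t (f l).
Hypothesis W_le2 : forall l t r, 0 <= t -> 0 <= r -> `|W l t r| <= 2.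
Hypothesis f_le2 : forall l t, 0 <= t -> `|f l t| <= 2 * lam t.
(** The implication is pointwise in [u] and for every [b], so it serves both with [b = 0] where the
    differences vanish and with the current bound later on. *)
Hypothesis Ff_le : forall b u, 0 <= u ->
  (forall l r, 0 <= r -> `|W l u r| <= b * 2 ^+ l) ->
  forall l x, u <= x -> `|F l x u| <= 8 * (b * 2 ^+ l) * lam u /\
                        `|f l u| <= 8 * (b * 2 ^+ l) * lam u.

Let A l t := integ t (w l).

Let bounded_by t1 b := forall l t, 0 <= t -> t <= t1 ->
  `|A l t| <= b * 2 ^+ l /\ forall r, 0 <= r -> `|W l t r| <= b * 2 ^+ l.

Let exists_bound t1 : 0 <= t1 -> exists b, bounded_by t1 b.
Proof.
move=> t10; pose L := integ t1 lam.
have L0 : 0 <= L by apply: Rintegral_ge0 => u /=; rewrite in_itv/= => /andP[/lam0].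
pose a := integ t1 (fun u => `|w 0 u|).
have a0 : 0 <= a by apply: Rintegral_ge0.
(* [a] bounds [A 0], and passing from [A l] to [A l.+1] adds at most [2 + 2 * L]; doubling the
   weight absorbs this since [2 + 2 * L] is at most the chosen constant. *)
exists (a + 2 + 2 * L).
have b0 : 0 <= a + 2 + 2 * L by lra.
have p1 l : 1 <= 2 ^+ l :> R by rewrite exprn_ege1//; lra.
move=> l t t0 tt1; split; last first.
  move=> r r0; apply: le_trans (W_le2 _ t0 r0) _; have := p1 l; nra.
elim: l => [|l ih].
  rewrite expr0 mulr1; apply: (@le_trans _ _ a); last by lra.
  apply: le_trans (_ : _ <= integ t (fun u => `|w 0 u|)) _.
    by apply: norm_integ_le => //; [exact: iw|exact/intg_norm/iw].
  by apply: ge0_integ_mono => //; exact/intg_norm/iw.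
have -> : A l.+1 t = A l t - W l t 0 + integ t (f l) by rewrite Wt0// /A; ring.
have fL : `|integ t (f l)| <= 2 * L.
  apply: le_trans (_ : _ <= integ t (fun u => 2 * lam u)) _.
    apply: norm_integ_le => //; [exact: jf|exact/intgZ/ilam|].
    by move=> u u0 _; apply: f_le2; exact: ltW.
  rewrite integZ; last exact: ilam.
  rewrite ler_wpM2l//; apply: ge0_integ_mono => //; first exact: ilam.
  by move=> u u0 _; exact: lam0.
apply: le_trans (ler_normD _ _) _; apply: le_trans (lerD (ler_normB _ _) fL) _.
have := W_le2 l t0 (lexx 0); have := p1 l; rewrite exprS; nra.
Qed.

(* Before time ts everything vanishes, so only the increments of t and of
   int lam over [ts, t1] enter; if they are small, the bound b improves to b/2. *)
Let halve ts t1 b : 0 <= ts -> ts <= t1 ->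
  (forall l s, 0 <= s -> s < ts -> A l s = 0 /\ forall r, 0 <= r -> W l s r = 0) ->
  H * (t1 - ts) <= 160^-1 -> integ t1 lam - integ ts lam <= 160^-1 ->
  bounded_by t1 b -> bounded_by t1 (b / 2).
Proof.
move=> ts0 tst1 zero kH kL bd.
have b0 : 0 <= b.
  have [+ _] := bd 0%N 0 (lexx 0) (le_trans ts0 tst1).
  by rewrite expr0 mulr1; apply: le_trans.
have p0 l : 0 < 2 ^+ l :> R by rewrite exprn_gt0.
have bp0 l : 0 <= b * 2 ^+ l by rewrite mulr_ge0// ltW.
(* Before [ts] the source [k] vanishes by the case [b' = 0]; after it, the factor [8] meets [160^-1]
   and leaves [1/20]. *)
have small l t k : ts <= t -> t <= t1 -> intg t k ->
    (forall u b', 0 <= u -> u <= t ->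
       (forall l r, 0 <= r -> `|W l u r| <= b' * 2 ^+ l) ->
       `|k u| <= 8 * (b' * 2 ^+ l) * lam u) ->
    `|integ t k| <= b * 2 ^+ l / 20.
  move=> tst tt1 ik kb; have t0 := le_trans ts0 tst.
  have z : integ ts k = 0.
    apply/eqP; rewrite -normr_le0.
    apply: le_trans (_ : _ <= integ ts (fun=> 0)) _; last by rewrite integ_cst// mul0r.
    apply: norm_integ_le => //; [exact: intgS ik|exact: intg_cst|].
    move=> u u0 uts; have -> : 0 = 8 * (0 * 2 ^+ l) * lam u by ring.
    apply: kb; [exact: ltW|lra|].
    by move=> l' r r0; rewrite (zero l' u (ltW u0) uts).2// normr0 mul0r.
  rewrite -[integ t k]subr0 -z.
  have := @norm_integ_diff_le _ ts t k (fun u => 8 * (b * 2 ^+ l) * lam u) ts0 tst ik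
    (intgZ _ (ilam t0)).
  move=> /(_ _)/le_trans; apply.
    move=> u tsu ut; have u0 : 0 <= u by lra.
    apply: kb => //; first exact: ltW.
    by move=> l' r r0; apply: (bd l' u u0 _).2 => //; lra.
  rewrite !integZ; [|exact: ilam|exact: ilam].
  have : integ t lam <= integ t1 lam.
    apply: ge0_integ_mono => //; first exact/ilam/(le_trans t0).
    by move=> u u0 _; exact: lam0.
  have := bp0 l; nra.
(* The weight at index [l.+1] is [2 * 2 ^+ l], whence [2/160 = 1/80]. *)
have abel l t r : ts <= t -> t <= t1 -> 0 <= r ->
    `|integ t (fun u => B (t + r - u) * w l.+1 u) - B r * A l.+1 t|
      <= b * 2 ^+ l / 80.
  move=> tst tt1 r0; have t0 := le_trans ts0 tst.
  have := @norm_integM_sub_le _ (fun u => B (t + r - u)) (w l.+1) H (b * 2 ^+ l.+1) ts t.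
  rewrite (_ : t + r - t = r); last by ring.
  move=> ab; apply: le_trans (ab H0 ts0 tst _ _ _ _ _) _.
  - move=> x y x0 xy yt; rewrite distrC.
    by have := @Blip (t + r - y) (t + r - x) ltac:(lra); congr (_ <= _ * _); ring.
  - exact: iw.
  - exact: iBw.
  - by move=> s s0 sts; exact: (zero l.+1 s s0 sts).1.
  - by move=> s tss st; apply: (bd l.+1 s _ _).1; lra.
  have : H * (t - ts) <= 160^-1 by apply: le_trans kH; rewrite ler_wpM2l// lerD2r.
  have := bp0 l; rewrite exprS; nra.
(* Equating the two formulas for [W l t 0] and using [B 0 = 1] isolates [A l t]; the errors add up
   to [1/80 + 1/20 + 1/20 <= 1/8]. *)
have As l t : ts <= t -> t <= t1 -> `|A l t| <= b * 2 ^+ l / 8.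
  move=> tst tt1; have t0 := le_trans ts0 tst.
  have Fs := small l t (F l (t + 0)) tst tt1 (iF l t0 (lexx 0))
    (fun u b' u0 ut hb => (Ff_le u0 hb l (ler_wpDr (lexx 0) ut)).1).
  have fs := small l t (f l) tst tt1 (jf l t0)
    (fun u b' u0 ut hb => (Ff_le u0 hb l (lexx u)).2).
  have ab := abel l t 0 tst tt1 (lexx 0).
  have -> : A l t = - (integ t (fun u => B (t + 0 - u) * w l.+1 u) - B 0 * A l.+1 t)
      + integ t (F l (t + 0)) - integ t (f l).
    have := Wt0 l t0; rewrite Wtr// B0 -/(A l t) -/(A l.+1 t); lra.
  apply: le_trans (ler_normB _ _) _.
  apply: le_trans (lerD (ler_normD _ _) (lexx _)) _.
  by rewrite normrN; have := bp0 l; lra.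
move=> l t t0 tt1; have [tts|tst] := ltP t ts.
  have [-> Z] := zero l t t0 tts; rewrite normr0; have := bp0 l; split; first by lra.
  by move=> r r0; rewrite Z// normr0; lra.
split; first by have := As l t tst tt1; have := bp0 l; lra.
move=> r r0; rewrite Wtr//.
have Fs := small l t (F l (t + r)) tst tt1 (iF l t0 r0)
    (fun u b' u0 ut hb => (Ff_le u0 hb l (ler_wpDr r0 ut)).1).
have ab := abel l t r tst tt1 r0.
have A1 := As l.+1 t tst tt1.
(* The improved bound on [A] at index [l.+1] costs a factor 2, and [1/80 + 1/4 + 1/20 <= 1/2] closes
   the estimate of [W]. *)
have BA : `|B r * A l.+1 t| <= b * 2 ^+ l / 4.
  have /andP[Br0 Br1] := B01 r; rewrite normrM (gtr0_norm Br0).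
  apply: (@le_trans _ _ `|A l.+1 t|); first by rewrite ler_piMl.
  by apply: le_trans A1 _; rewrite exprS; lra.
rewrite -[integ t (fun u => _)](subrK (B r * A l.+1 t)) opprD.
apply: le_trans (ler_normD _ _) _; apply: le_trans (lerD (ler_normB _ _) Fs) _.
by move: ab BA; rewrite normrN; have := bp0 l; lra.
Qed.

(** Real induction in time, for all [l] at once because each estimate calls on the next index. The
    interval [[ts, t1]] does not depend on [b], so [halve] can be iterated on it indefinitely. *)
Lemma hierarchy_eq0 l t r : 0 <= t -> 0 <= r -> W l t r = 0.
Proof.
move=> t0; move: r.
suff [] : A l t = 0 /\ forall r, 0 <= r -> W l t r = 0 by [].
move: t t0 l; apply: real_induction => ts ts0 zero.
have e0 : 0 < 160^-1 :> R by rewrite invr_gt0; lra.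
have [t2 tst2 L2] := integ_right_small ts0 e0 ilam.
pose d := (160 * (H + 1))^-1.
have d0 : 0 < d by rewrite invr_gt0; move: H0; lra.
have dH : H * d <= 160^-1.
  rewrite /d invfM mulrCA ler_piMr ?invr_ge0// ler_pdivrMr; move: H0; lra.
pose t1 := Num.min t2 (ts + d).
have tst1 : ts < t1 by rewrite lt_min tst2; lra.
have t1t2 : t1 <= t2 by rewrite ge_min lexx.
have t1d : t1 <= ts + d by rewrite ge_min lexx orbT.
exists t1 => // s tss st1 l.
have s0 := le_trans ts0 tss.
have t10 := le_trans s0 st1.
have [b bd] := exists_bound t10.
have bdn n : bounded_by t1 (b / 2 ^+ n).
  elim: n => [|n ih]; first by rewrite expr0 divr1.
  rewrite exprS invfM mulrCA mulrC; apply: (halve ts0 (ltW tst1)) ih.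
  - by move=> l' s' s'0 s'ts; exact: zero.
  - by apply: le_trans dH; rewrite ler_wpM2l//; lra.
  - have : integ t1 lam <= integ t2 lam.
      apply: ge0_integ_mono => //; first exact/ilam/(le_trans t10).
      by move=> u u0 _; exact: lam0.
    by move: L2 => /ltr_normlP[_]; lra.
(* For fixed [l] the bound tends to [0], by [n <= 2 ^+ n]. *)
have to0 (x : R) : (forall n, `|x| <= b / 2 ^+ n * 2 ^+ l) -> x = 0.
  move=> xb; apply/eqP; rewrite -normr_le0; apply/ler_addgt0Pr => e ep; rewrite add0r.
  pose c := `|b * 2 ^+ l| / e.
  have c0 : 0 <= c by rewrite divr_ge0// ltW.
  have [n cn] : exists n : nat, c < n%:R.
    by exists (Num.Def.truncn c).+1; exact: truncnS_gt.
  have n2 : (n%:R : R) <= 2 ^+ n by rewrite -natrX ler_nat ltnW// ltn_expl.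
  have p0 : 0 < 2 ^+ n :> R by rewrite exprn_gt0.
  apply: le_trans (xb n) _; rewrite mulrAC ler_pdivrMr//.
  apply: le_trans (ler_norm _) _; rewrite [e * _]mulrC -ler_pdivrMr//.
  by apply: le_trans (ltW cn) n2.
split; first by apply: to0 => n; exact: (bdn n l s s0 st1).1.
by move=> r r0; apply: to0 => n; exact: (bdn n l s s0 st1).2.
Qed.

End LinearHierarchy.

(** * Uniform indexing of the equations and estimates of the arrival terms *)

Section Sources.
Context {R : realType}.
Variables (B lam : R -> R).
Implicit Types (Z : nat -> R -> R -> R) (Y : nat -> R -> R).

(* Indices are shifted by one: [source Z l] is the arrival term of Z_(l+1). *)
Definition source Z (l : nat) (x u : R) : R :=
  if l is 0 then lam u * B (x - u) * (1 - Z 1%N u 0 ^+ 2)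
  else lam u * (Z l u 0 + Z l.+1 u 0) * (Z l u (x - u) - Z l.+1 u (x - u)).

Definition source0 Z (l : nat) (u : R) : R :=
  if l is 0 then lam u * (1 - Z 1%N u 0 ^+ 2)
  else lam u * (Z l u 0 ^+ 2 - Z l.+1 u 0 ^+ 2).

Lemma solves_hydro_interior Y Z : solves_hydro B lam Y Z ->
  forall l t r, 0 <= t -> 0 <= r ->
  [/\ intg t (fun u => B (t + r - u) * dr0 (Z l.+2 u)),
      intg t (source Z l (t + r)) &
      Z l.+1 t r = Y l.+1 (t + r)
        - integ t (fun u => B (t + r - u) * dr0 (Z l.+2 u))
        + integ t (source Z l (t + r))].
Proof.
move=> [e1 [_ [e3 _]]] [|l] t r t0 r0.
  by have [? [? ?]] := e1 t r t0 r0.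
by have [? [? ?]] := e3 l.+2 t r isT t0 r0.
Qed.

Lemma solves_hydro_boundary Y Z : solves_hydro B lam Y Z ->
  forall l t, 0 <= t ->
  [/\ intg t (fun u => dr0 (Z l.+1 u) - dr0 (Z l.+2 u)),
      intg t (source0 Z l) &
      Z l.+1 t 0 = Y l.+1 0
        + integ t (fun u => dr0 (Z l.+1 u) - dr0 (Z l.+2 u))
        + integ t (source0 Z l)].
Proof.
move=> [_ [e2 [_ e4]]] [|l] t t0.
  by have [? [? ?]] := e2 t t0.
by have [? [? ?]] := e4 l.+2 t isT t0.
Qed.

Lemma norm_sqr_sub_le (a a' b : R) : `|a| <= 1 -> `|a'| <= 1 -> `|a - a'| <= b ->
  `|a ^+ 2 - a' ^+ 2| <= 2 * b.
Proof.
move=> a1 a1' ab; rewrite subr_sqr normrM mulrC.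
apply: ler_pM => //; apply: le_trans (ler_normD _ _) _; lra.
Qed.

(** Change one factor at a time: the factor kept is a sum or difference of two numbers in [[-1, 1]],
    hence at most 2, and the changed one moves by at most [b1 + b2]. *)
Lemma norm_bilin_sub_le (a c p q a' c' p' q' b1 b2 : R) :
  `|p| <= 1 -> `|q| <= 1 -> `|a'| <= 1 -> `|c'| <= 1 ->
  `|a - a'| <= b1 -> `|p - p'| <= b1 -> `|c - c'| <= b2 -> `|q - q'| <= b2 ->
  `|(a + c) * (p - q) - (a' + c') * (p' - q')| <= 4 * (b1 + b2).
Proof.
move=> p1 q1 a1 c1 ha hp hc hq.
have -> : (a + c) * (p - q) - (a' + c') * (p' - q') =
  ((a - a') + (c - c')) * (p - q) + (a' + c') * ((p - p') - (q - q')) by ring.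
have -> : 4 * (b1 + b2) = (b1 + b2) * 2 + 2 * (b1 + b2) by ring.
apply: le_trans (ler_normD _ _) _; rewrite !normrM; apply: lerD; apply: ler_pM => //.
- by apply: le_trans (ler_normD _ _) _; lra.
- by apply: le_trans (ler_normB _ _) _; lra.
- by apply: le_trans (ler_normD _ _) _; lra.
- by apply: le_trans (ler_normB _ _) _; lra.
Qed.

Variables Z Z' : nat -> R -> R -> R.
Hypothesis Z1 : forall l t r, 0 <= t -> 0 <= r -> `|Z l.+1 t r| <= 1.
Hypothesis Z1' : forall l t r, 0 <= t -> 0 <= r -> `|Z' l.+1 t r| <= 1.
Hypothesis lam0 : forall t, 0 <= t -> 0 <= lam t.
Hypothesis B01 : forall x, 0 < B x <= 1.

(** Squares of the boundary values lie in [[0, 1]]. This crude bound feeds the a priori estimate. *)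
Lemma source0_sub_le2 l u : 0 <= u ->
  `|source0 Z l u - source0 Z' l u| <= 2 * lam u.
Proof.
move=> u0.
have sq (x : R) : `|x| <= 1 -> 0 <= x ^+ 2 <= 1.
  by move=> x1; rewrite sqr_ge0 -real_normK ?num_real// expr_le1.
have l0 := lam0 u0.
have s1 k := sq _ (Z1 k u0 (lexx 0)); have s1' k := sq _ (Z1' k u0 (lexx 0)).
case: l => [|l] /=; rewrite -mulrBr normrM (ger0_norm l0) mulrC ler_wpM2r//.
  by rewrite ler_norml; have := s1 0%N; have := s1' 0%N; lra.
by rewrite ler_norml; have := s1 l; have := s1' l; have := s1 l.+1; have := s1' l.+1; lra.
Qed.

Lemma source_sub_le b u : 0 <= u ->
  (forall l r, 0 <= r -> `|Z l.+1 u r - Z' l.+1 u r| <= b * 2 ^+ l) ->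
  forall l x, u <= x ->
  `|source Z l x u - source Z' l x u| <= 8 * (b * 2 ^+ l) * lam u /\
  `|source0 Z l u - source0 Z' l u| <= 8 * (b * 2 ^+ l) * lam u.
Proof.
move=> u0 hb l x ux; have l0 := lam0 u0; have xu : 0 <= x - u by lra.
have b0 : 0 <= b.
  by have := hb 0%N 0 (lexx _); rewrite expr0 mulr1; apply: le_trans.
case: l => [|l] /=.
  have sq : `|Z 1%N u 0 ^+ 2 - Z' 1%N u 0 ^+ 2| <= 2 * b.
    by apply: norm_sqr_sub_le; [exact: Z1|exact: Z1'|];
      have := hb 0%N 0 (lexx _); rewrite expr0 mulr1.
  have := sq; rewrite ler_norml expr0 mulr1 => sq'.
  rewrite -!mulrBr !normrM (ger0_norm l0).
  have /andP[Br0 Br1] := B01 (x - u); rewrite (gtr0_norm Br0).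
  have -> : 1 - Z 1%N u 0 ^+ 2 - (1 - Z' 1%N u 0 ^+ 2) =
    - (Z 1%N u 0 ^+ 2 - Z' 1%N u 0 ^+ 2) by ring.
  rewrite normrN.
  have lb : lam u * `|Z 1%N u 0 ^+ 2 - Z' 1%N u 0 ^+ 2| <= 8 * b * lam u.
    by rewrite mulrC ler_wpM2r//; lra.
  split => //; apply: le_trans lb; rewrite -mulrA ler_wpM2l// ler_piMl//.
have p0 : 0 <= b * 2 ^+ l by rewrite mulr_ge0// exprn_ge0.
(* With [p = b * 2 ^+ l] the two indices involved have bounds [p] and [2 * p]. The interior term
   costs [4 * (p + 2 * p) = 12 * p] and the boundary term [6 * p], both below the [16 * p]
   allowed. *)
have pS : b * 2 ^+ l.+1 = 2 * (b * 2 ^+ l) by rewrite exprS; ring.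
have h1 := hb l; have h2 := hb l.+1; rewrite pS in h2 *.
split.
  rewrite -[X in `|X - _|]mulrA -[X in `|_ - X|]mulrA -mulrBr normrM (ger0_norm l0) mulrC ler_wpM2r//.
  apply: le_trans (@norm_bilin_sub_le _ _ _ _ _ _ _ _ _ _ _ _ _ _ (h1 _ _) (h1 _ _) (h2 _ _) (h2 _ _)) _ => //;
    rewrite ?Z1 ?Z1'//; lra.
rewrite -mulrBr normrM (ger0_norm l0) mulrC ler_wpM2r//.
have -> : Z l.+1 u 0 ^+ 2 - Z l.+2 u 0 ^+ 2 - (Z' l.+1 u 0 ^+ 2 - Z' l.+2 u 0 ^+ 2)
  = (Z l.+1 u 0 ^+ 2 - Z' l.+1 u 0 ^+ 2) - (Z l.+2 u 0 ^+ 2 - Z' l.+2 u 0 ^+ 2) by ring.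
apply: le_trans (ler_normB _ _) _.
have := norm_sqr_sub_le (Z1 l u0 (lexx 0)) (Z1' l u0 (lexx 0)) (h1 0 (lexx 0)).
have := norm_sqr_sub_le (Z1 l.+1 u0 (lexx 0)) (Z1' l.+1 u0 (lexx 0)) (h2 0 (lexx 0)).
lra.
Qed.

End Sources.

(** * Reduction of uniqueness to the linear hierarchy *)

Theorem theorem4p1 (R : realType) (G g : R -> R) (H : R) (lam : R -> R)
    (Z0 : nat -> R -> R) :
  good_G G g H ->
  good_lambda lam ->
  (forall l : nat, (1 <= l)%N -> C1le1 (Z0 l)) ->
  forall Z Z' : nat -> R -> R -> R,
    (forall l : nat, (1 <= l)%N -> inX (Z l)) ->
    (forall l : nat, (1 <= l)%N -> inX (Z' l)) ->
    solves_hydro (fun x => 1 - G x) lam Z0 Z ->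
    solves_hydro (fun x => 1 - G x) lam Z0 Z' ->
    forall (l : nat) (t r : R), (1 <= l)%N -> 0 <= t -> 0 <= r ->
      Z l t r = Z' l t r.
Proof.
move=> hG [lam0 ilam] _ Z Z' XZ XZ' sZ sZ' [//|l] t r _ t0 r0.
have Z1 k s q : 0 <= s -> 0 <= q -> `|Z k.+1 s q| <= 1.
  by move=> s0; have [/(_ _ s0)[+ _] _] := XZ k.+1 isT; exact.
have Z1' k s q : 0 <= s -> 0 <= q -> `|Z' k.+1 s q| <= 1.
  by move=> s0; have [/(_ _ s0)[+ _] _] := XZ' k.+1 isT; exact.
pose B x := 1 - G x.
(* From index 2 on, integrability of the derivative comes from the interior equation at [r = 0] by
   removing the tail; at index 1 it comes from the difference in the boundary equation. *)
have idr Y : solves_hydro B lam Z0 Y ->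
    forall k s, 0 <= s -> intg s (fun u => dr0 (Y k.+1 u)).
  move=> sY.
  have i2 k s : 0 <= s -> intg s (fun u => dr0 (Y k.+2 u)).
    move=> s0; have [+ _ _] := solves_hydro_interior sY k s0 (lexx 0).
    rewrite addr0; exact: (intg_div_tail hG).
  case=> [|k] s s0; last exact: i2.
  have [i12 _ _] := solves_hydro_boundary sY 0 s0.
  have -> : (fun u => dr0 (Y 1%N u)) =
      (fun u => dr0 (Y 1%N u) - dr0 (Y 2%N u) + dr0 (Y 2%N u)).
    by apply/funext => u; rewrite subrK.
  by apply: intgD; [|exact: i2].
have iZ := idr _ sZ; have iZ' := idr _ sZ'.
have iBB k s q (s0 : 0 <= s) (q0 : 0 <= q) : intg s (fun u =>
    B (s + q - u) * dr0 (Z k.+2 u) - B (s + q - u) * dr0 (Z' k.+2 u)).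
  have [? _ _] := solves_hydro_interior sZ k s0 q0.
  have [? _ _] := solves_hydro_interior sZ' k s0 q0.
  exact: intgB.
have BB k s q : (fun u => B (s + q - u) * (dr0 (Z k.+2 u) - dr0 (Z' k.+2 u)))
    = (fun u => B (s + q - u) * dr0 (Z k.+2 u) - B (s + q - u) * dr0 (Z' k.+2 u)).
  by apply/funext => u; rewrite mulrBr.
apply/eqP; rewrite -subr_eq0; apply/eqP.
(* The common initial data cancel in the difference, so the hierarchy is homogeneous; [|H|] serves
   as the nonnegative Lipschitz constant of the tail. *)
apply: (@hierarchy_eq0 R B lam `|H| (fun k s q => Z k.+1 s q - Z' k.+1 s q)
  (fun k u => dr0 (Z k.+1 u) - dr0 (Z' k.+1 u))
  (fun k x u => source B lam Z k x u - source B lam Z' k x u)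
  (fun k u => source0 lam Z k u - source0 lam Z' k u)) => //.
- exact: (tail_bounds hG).
- by rewrite /B (distr0 hG) subr0.
- exact: (tail_lipschitz hG).
- by move=> k s s0; apply: intgB; [exact: iZ|exact: iZ'].
- by move=> k s q s0 q0; rewrite BB; exact: iBB.
- move=> k s q s0 q0.
  have [_ ? _] := solves_hydro_interior sZ k s0 q0.
  have [_ ? _] := solves_hydro_interior sZ' k s0 q0.
  exact: intgB.
- move=> k s s0.
  have [_ ? _] := solves_hydro_boundary sZ k s0.
  have [_ ? _] := solves_hydro_boundary sZ' k s0.
  exact: intgB.
- move=> k s q s0 q0.
  have [a1 a2 ->] := solves_hydro_interior sZ k s0 q0.
  have [b1 b2 ->] := solves_hydro_interior sZ' k s0 q0.
  by rewrite BB !integB//; ring.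
- move=> k s s0.
  have [_ a2 ->] := solves_hydro_boundary sZ k s0.
  have [_ b2 ->] := solves_hydro_boundary sZ' k s0.
  have i1 := iZ k s s0; have i2 := iZ k.+1 s s0.
  have i1' := iZ' k s s0; have i2' := iZ' k.+1 s s0.
  rewrite (integB i1 i2) (integB i1' i2') (integB i1 i1') (integB i2 i2').
  by rewrite (integB a2 b2); ring.
- move=> k s q s0 q0; apply: le_trans (ler_normB _ _) _.
  by have := Z1 k s q s0 q0; have := Z1' k s q s0 q0; lra.
- by move=> k s s0; exact: source0_sub_le2.
- by move=> b u u0 hb k x ux; apply: source_sub_le => //; exact: (tail_bounds hG).
Qed.
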